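(* Let $K$ be a simplicial complex with a discrete Morse function and associated gradient vector field $V$. Let $\widetilde{F_0}$ be a critical flowline (of index 2), suppose the algorithm $\mathrm{AlgList}_c$ applied to $\widetilde{F_0}$ returns the list of flowlines $[\widetilde{F_0},F_1,\dots,F_{n-1},\widetilde{F_n}]$ of length $n+1$, and write $\widetilde{F_n}=\mathrm{Alg}_c(\widetilde{F_0})$ for its last entry, a critical flowline. Then the algorithm is involutive on critical flowlines: applying $\mathrm{AlgList}_c$ to $\widetilde{F_n}$ gives a list $$[\widetilde{F_n},F_{n+1},\dots,F_{n+m-1},\widetilde{F_0}]$$ that terminates at $\widetilde{F_0}$; moreover, writing $F_{n+i}$ for the entry in position $i$ (starting from $0$) of this second list and $F_{n-i}$ for the entry in position $n-i$ of the first list, one has $F_{n-i}=F_{n+i}$ for all $0\le i\le n$, and if $F_{n+i}$ has label $\ell$ in the second list then $F_{n-i}$ has the conjugate label $\overline{\ell}$ in the first list.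
   Context: A simplicial complex $K$ is a collection of finite nonempty subsets (simplices) of a vertex set closed under taking nonempty subsets; $\sigma^{(p)}$ denotes a simplex of dimension $p$ ($p+1$ vertices); a facet of $\sigma^{(p)}$ is a face of dimension $p-1$. A discrete Morse function is $f:K\to\mathbb{R}$ such that for each $\beta^{(p)}$ there is at most one facet $\gamma^{(p-1)}<\beta$ with $f(\gamma)\ge f(\beta)$ and at most one $\alpha^{(p+1)}>\beta$ with $f(\alpha)\le f(\beta)$. Its gradient vector field $V$ is the set of pairs $\{\sigma^{(p)}<\tau^{(p+1)}\}$ with $f(\sigma)\ge f(\tau)$; each simplex is in at most one pair. A simplex in no pair of $V$ is critical. The modified Hasse diagram has an arrow $\tau\to\sigma$ for each facet $\sigma$ of $\tau$, except that for each pair $\{\sigma<\tau\}\in V$ the arrow is reversed to $\sigma\to\tau$ (a Morse arrow). A flowline is a directed path in the modified Hasse diagram from a critical simplex $\alpha$ to a critical simplex $\gamma$; its index is $\dim\alpha-\dim\gamma$. Here ''flowline'' means flowline of index 2, with $\dim\alpha=n_0+1$, $\dim\gamma=n_0-1$. Index-2 paths (possibly illegal): sequences of simplices from critical $\alpha$ to critical $\gamma$ with $\dim\alpha=\dim\gamma+2$, each step going either up along a Morse arrow or down from a simplex to one of its facets. A down step from $\tau$ to $\sigma$ with $\{\sigma<\tau\}\in V$ is a backward arrow. The path is illegal if it contains a backward arrow, legal otherwise; legal index-2 paths are exactly the flowlines. Such a path contains exactly one double drop (two consecutive down steps) $\alpha_i\to\beta\to\gamma_i$; $\beta$ is its intermediate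 simplex. A flowline is critical if its intermediate simplex is a critical simplex. Floperations: - Flop: replaces the intermediate simplex $\beta$ in the double drop $\alpha_i\to\beta\to\gamma_i$ by the unique $\beta'\ne\beta$ which is a facet of $\alpha_i$ having $\gamma_i$ as a facet. - Insert (applied to a noncritical flowline): if $\beta$ is paired in $V$ with a simplex $\delta$ (of dimension one higher or one lower), the occurrence $\beta$ of the intermediate simplex is replaced by $\beta,\delta,\beta$. - Cancel (applied to an illegal path with a backward arrow adjacent to its intermediate simplex $\beta$): that backward arrow joins $\beta$ to its $V$-partner $\delta$, and the path contains $\beta,\delta,\beta$ consecutively; this is replaced by the single $\beta$. Algorithm. $\mathrm{AlgList}_c(F)$, for a flowline $F$: begin the list with $(F,\text{c})$ and put $P:=F$. Step 1: replace $P$ by $\mathrm{Flop}(P)$. Step 2: while $P$ is illegal, replace $P$ by $\mathrm{Cancel}(P)$, append $(P,\text{c})$ to the list, and replace $P$ by $\mathrm{Flop}(P)$. Step 3: once $P$ is legal, append $(P,\text{f})$; if $P$ is critical, terminate; otherwise replace $P$ by $\mathrm{Insert}(P)$ and return to Step 1. If it terminates, $\mathrm{Alg}_c(F)$ is the last flowline of the list. Conjugate labels: $\overline{\text{c}}=\text{f}$, $\overline{\text{f}}=\text{c}$. *)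

(* Defs.v *)
From HB Require Import structures.
From mathcomp Require Import all_boot all_order all_algebra.
From mathcomp Require Import finmap.
From mathcomp Require Import boolp classical_sets reals.
Set Implicit Arguments.
Unset Strict Implicit.
Unset Printing Implicit Defensive.

Import Order.TTheory GRing.Theory Num.Theory.

Local Open Scope classical_set_scope.
Local Open Scope fset_scope.

(* cs is the label c of the algorithm and fs is its label f. *)
Inductive label := cs | fs.

Definition conj_label (l : label) : label :=
  match l with cs => fs | fs => cs end.

Section DiscreteMorse.
Variables (R : realType) (T : choiceType).

Local Notation simplex := {fset T}.

(* K may be infinite. *)
Definition simplicial_complex (K : set simplex) : Prop :=
  (forall s, K s -> s != fset0) /\
  (forall s t, K t -> s `<=` t -> s != fset0 -> K s).

(* Only meaningful for nonempty s. *)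
Definition dim (s : simplex) : nat := #|` s|.-1.

Definition facet (s t : simplex) : Prop := s `<=` t /\ dim t = (dim s).+1.

(* f is only used at the simplices of K. *)
Variables (K : set simplex) (f : simplex -> R).

Definition discrete_morse : Prop :=
  forall b, K b ->
    is_subset1 [set c | K c /\ facet c b /\ (f b <= f c)%R] /\
    is_subset1 [set a | K a /\ facet b a /\ (f a <= f b)%R].

(* The pair {s < t} belongs to the gradient vector field. *)
Definition gradient (s t : simplex) : Prop :=
  [/\ K s, K t, facet s t & (f t <= f s)%R].

Definition partner (s t : simplex) : Prop := gradient s t \/ gradient t s.

Definition critical_simplex (s : simplex) : Prop :=
  K s /\ forall t, ~ partner s t.

(* The arrow a -> b of the modified Hasse diagram. *)
Definition hasse_arrow (a b : simplex) : Prop :=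
  gradient a b \/ [/\ K a, K b, facet b a & ~ gradient b a].

(* Flowlines of index 2, given by the sequence of simplices they visit. *)
Definition flowline (P : seq simplex) : Prop :=
  exists a s, let c := last a s in
    [/\ P = a :: s,
        critical_simplex a /\ critical_simplex c,
        dim a = (dim c + 2)%N &
        forall x y, infix [:: x; y] P -> hasse_arrow x y].

Definition illegal (P : seq simplex) : Prop :=
  exists t s, infix [:: t; s] P /\ gradient s t.

(* a -> b -> c is a double drop of P, located between p and q; an index-2 path
   has exactly one, and b is then its intermediate simplex. *)
Definition double_drop (P p : seq simplex) (a b c : simplex) (q : seq simplex)
  : Prop :=
  [/\ P = p ++ [:: a; b; c] ++ q, facet b a & facet c b].

Definition critical_flowline (P : seq simplex) : Prop :=
  flowline P /\
  exists p a b c q, double_drop P p a b c q /\ critical_simplex b.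

Definition is_flop (P Q : seq simplex) : Prop :=
  exists p a b c q b',
    [/\ double_drop P p a b c q, b' <> b, facet b' a, facet c b' &
        Q = p ++ [:: a; b'; c] ++ q].

Definition is_insert (P Q : seq simplex) : Prop :=
  exists p a b c q d,
    [/\ double_drop P p a b c q, partner b d &
        Q = p ++ [:: a; b; d; b; c] ++ q].

(* The backward arrow is d -> b, entering the intermediate simplex, in the first
   case and b -> d, leaving it, in the second case. *)
Definition is_cancel (P Q : seq simplex) : Prop :=
  (exists p b d c q,
     [/\ double_drop P (rcons p b) d b c q, gradient b d &
         Q = p ++ [:: b; c] ++ q]) \/
  (exists p a b d q,
     [/\ double_drop P p a b d (b :: q), gradient d b &
         Q = p ++ [:: a; b] ++ q]).

(* "The" result of each operation; P itself is a junk value, returned when the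
   operation does not apply. *)
Definition flop (P : seq simplex) : seq simplex := xget P [set Q | is_flop P Q].
Definition insert (P : seq simplex) : seq simplex :=
  xget P [set Q | is_insert P Q].
Definition cancel (P : seq simplex) : seq simplex :=
  xget P [set Q | is_cancel P Q].

(* alg_loop P L: resumed at the test "while P is illegal" of Step 2 with current
   path P, the algorithm terminates, and from there on it appends the entries L. *)
Inductive alg_loop : seq simplex -> seq (seq simplex * label) -> Prop :=
| alg_cancel P L : illegal P ->
    alg_loop (flop (cancel P)) L -> alg_loop P ((cancel P, cs) :: L)
| alg_stop P : ~ illegal P -> critical_flowline P ->
    alg_loop P [:: (P, fs)]
| alg_insert P L : ~ illegal P -> ~ critical_flowline P ->
    alg_loop (flop (insert P)) L -> alg_loop P ((P, fs) :: L).

(* AlgList_c, applied to F, terminates and returns the list L; Alg_c(F) is then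
   last F (unzip1 L). *)
Definition alg_list (F : seq simplex) (L : seq (seq simplex * label)) : Prop :=
  exists L', L = (F, cs) :: L' /\ alg_loop (flop F) L'.

End DiscreteMorse.

(* Main.v *)
Require Import Defs.
From mathcomp Require Import all_boot all_order all_algebra.
From mathcomp Require Import finmap.
From mathcomp Require Import boolp classical_sets reals.
From mathcomp Require Import zify.

(** The algorithm is a walk on labelled flowlines whose steps can be undone, and
    conjugating the labels turns a step into its inverse.

    Since no simplex is in two pairs, an index-two path never makes two
    consecutive up steps, and starts and ends with down steps. Hence it stays at
    or above its final dimension and at or below its initial one, and its double
    drop is the place where it leaves the initial dimension for good; it is
    therefore unique ([double_drop_uniq]). Between two simplices of codimension
    two there are exactly two others ([facet_diamond]), so that flopping is an
    involution ([flop_nearly_legal]). A simplex has at most one partner, so that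
    inserting and cancelling are inverse to each other ([insert_nearly_legal],
    [cancel_nearly_legal]); here it matters that every backward arrow of a path
    met by the algorithm touches the intermediate simplex.

    Now attach to a labelled flowline the path that the algorithm flops next:
    [F] itself under label [cs], and [insert F] under label [fs]. The path that
    the algorithm has just obtained when it lists a flowline [F'] is given by
    the same recipe after conjugating the label: it is [F'] under label [fs],
    and under label [cs] it is the illegal path that cancels to [F'], that is,
    [insert F']. So to step from [(F, l)] to [(F', l')] means that [flop]
    exchanges the path attached to [(F, l)] and the one attached to the
    conjugate of [(F', l')], a condition that is invariant under reversal
    together with conjugation ([next_conj]).

    Finally, the reversed run neither stops too early nor runs on. Flowlines
    obtained by cancelling are not critical, as their intermediate simplex is
    paired, and so none of them stops the reversed run, where they carry the
    label [fs]; the starting flowline is critical and does stop it. *)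

Set Implicit Arguments.
Unset Strict Implicit.
Unset Printing Implicit Defensive.

Import Order.TTheory.

(* The bare names denote notions of vector spaces and of functions here. *)
Local Notation dim := Defs.dim.
Local Notation cancel := Defs.cancel.

Local Notation chain e P := (sorted (fun x y => `[< e x y >]) P).
Local Notation chain_from e x P := (path (fun x y => `[< e x y >]) x P).

(** * Sequences *)

Lemma chainP (T : choiceType) (e : T -> T -> Prop) (P : seq T) :
  chain e P <-> forall x y, infix [:: x; y] P -> e x y.
Proof.
elim: P => [|x [|y P] IH]; [by split=> // _ u v; rewrite infixs0 | |].
  by split=> // _ u v; rewrite infix_consl /= andbF.
split=> [/andP[/asboolP exy /IH chP] u v|eP].
  rewrite infix_consl /= => /orP[/and3P[/eqP-> /eqP-> _] //|]; exact: chP.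
rewrite /=; apply/andP; split.
  by apply/asboolP/eP; rewrite infix_consl /= !eqxx prefix0s.
by apply/IH => u v uv; apply: eP; rewrite infix_consl uv orbT.
Qed.

(** The pivot of such a split is the last element of the sequence that
    satisfies [a], and this determines the split. *)
Lemma last_split_inj (T : eqType) (a : pred T) (p p' r r' : seq T) (x x' : T) :
    a x -> a x' -> ~~ has a r -> ~~ has a r' ->
  p ++ x :: r = p' ++ x' :: r' -> [/\ p = p', x = x' & r = r'].
Proof.
move=> ax ax' ar ar'; elim: p p' => [|y p IH] [|y' p'] /=.
- by case.
- by case=> _ Er; rewrite Er has_cat /= ax' orbT in ar.
- by case=> _ Er; rewrite -Er has_cat /= ax orbT in ar'.
- by case=> -> /IH[-> -> ->].
Qed.

Lemma head_rcons (T : Type) (x y : T) s : head x (rcons s y) = head y s.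
Proof. by case: s. Qed.

(** * The diamond property of faces *)

Section Fsets.
Variable T : choiceType.
Local Notation simplex := {fset T}.
Local Open Scope fset_scope.
Implicit Types r s t : simplex.

(** The truncated [dim] gives the empty set the dimension of a vertex, so that
    [facet] has its usual meaning above nonempty sets only. *)
Lemma facetP s t : s != fset0 ->
  facet s t <-> s `<=` t /\ #|` t| = #|` s|.+1.
Proof. by rewrite -cardfs_gt0 /facet /Defs.dim => s0; split=> -[]; lia. Qed.

(** The two vertices of [t] outside [r] can be added to [r] in two orders: a
    codimension-two pair of simplices has exactly two simplices in between. *)
Lemma facet_diamond r s t : r != fset0 -> facet r s -> facet s t ->
  exists s', [/\ s' != fset0, s' <> s, facet r s', facet s' t &
    forall u, u <> s -> facet r u -> facet u t -> u = s'].
Proof.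
move=> r0 rs st.
have nz u : facet r u -> u != fset0.
  move=> /(facetP _ r0)[_ uE]; rewrite -cardfs_gt0; lia.
have s0 := nz _ rs.
have [sub_rs cs] := (facetP _ r0).1 rs.
have [sub_st ct] := (facetP _ s0).1 st.
have cD : #|` t `\` s| = 1 by rewrite cardfsDS//; lia.
have cI : #|` r `&` (t `\` s)| = 0.
  apply/eqP; rewrite cardfs_eq0; apply/eqP/fsetP => x; rewrite !inE.
  by case xr: (x \in r) => //=; rewrite (fsubsetP sub_rs x xr).
set s' := r `|` (t `\` s).
have cs' : #|` s'| = #|` r|.+1.
  by have := cardfsUI r (t `\` s); rewrite cI cD -/s'; lia.
have rs' : facet r s' by apply/facetP => //; split; [exact: fsubsetUl|].
exists s'; split=> //; first exact: nz.
- move=> E; have [x xD] : exists x, x \in t `\` s.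
    by apply/fset0Pn; rewrite -cardfs_gt0 cD.
  have : x \in s' by rewrite inE xD orbT.
  by move: xD; rewrite E !inE => /andP[/negPf->].
- apply/facetP; first exact: nz; split; last by lia.
  by rewrite fsubUset (fsubset_trans sub_rs) // fsubDset fsubsetUr.
move=> u us ru ut.
have [sub_ru cu] := (facetP _ r0).1 ru.
have [sub_ut _] := (facetP _ (nz _ ru)).1 ut.
(* [u] and [s] have the same size, so that [r] is all of their intersection. *)
have Eus : r = u `&` s.
  apply/eqP; rewrite eqEfcard fsubsetI sub_ru sub_rs /=.
  have : u `&` s `<` u.
    rewrite fproperE fsubsetIl /= fsubsetI fsubset_refl /=.
    apply/negP => us'; apply: us; apply/eqP.
    by rewrite eqEfcard us'; lia.
  by move/fproper_ltn_card; lia.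
apply/eqP; rewrite eqEfcard; apply/andP; split; last by lia.
apply/fsubsetP => x xu; rewrite !inE Eus !inE xu (fsubsetP sub_ut _ xu) andbT.
exact: orbN.
Qed.
End Fsets.

(** * Gradient paths of index two *)

Section Paths.
Variables (R : realType) (T : choiceType).
Local Notation simplex := {fset T}.
Variables (K : set simplex) (f : simplex -> R).
Hypotheses (hK : simplicial_complex K) (hf : discrete_morse K f).
Local Open Scope fset_scope.

Local Notation gradient := (gradient K f).
Local Notation partner := (partner K f).
Local Notation critical := (critical_simplex K f).
Local Notation hasse := (hasse_arrow K f).
Local Notation legal P := (~ illegal K f P).

Lemma complex_neq0 s : K s -> s != fset0.
Proof. exact: hK.1. Qed.

Lemma gradient_lower_uniq s s' t : gradient s t -> gradient s' t -> s = s'.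
Proof.
by move=> [Ks Kt st le] [Ks' _ st' le']; apply: (hf Kt).1.
Qed.

Lemma gradient_upper_uniq s t t' : gradient s t -> gradient s t' -> t = t'.
Proof.
by move=> [Ks Kt st le] [_ Kt' st' le']; apply: (hf Ks).2.
Qed.

(** If [r < s < t] were two pairs, then the other simplex [s'] between [r] and
    [t] would satisfy [f r < f s' < f t], while [f t <= f s <= f r]. *)
Lemma gradient_trans_absurd r s t : gradient r s -> gradient s t -> False.
Proof.
move=> [Kr Ks rs le_sr] [_ Kt st le_ts].
have [s' [s'0 s's rs' s't _]] := facet_diamond (complex_neq0 Kr) rs st.
have Ks' : K s' by apply: (hK.2 _ _ Kt) => //; case: s't.
have lt_rs' : (f r < f s')%R.
  rewrite ltNge; apply/negP => le; apply: s's.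
  exact: ((hf Kr).2 _ _ (conj Ks' (conj rs' le)) (conj Ks (conj rs le_sr))).
have lt_s't : (f s' < f t)%R.
  rewrite ltNge; apply/negP => le; apply: s's.
  exact: ((hf Kt).1 _ _ (conj Ks' (conj s't le)) (conj Ks (conj st le_ts))).
have := lt_le_trans (lt_trans lt_rs' lt_s't) (le_trans le_ts le_sr).
by rewrite ltxx.
Qed.

Lemma gradient_dim s t : gradient s t -> dim t = (dim s).+1.
Proof. by case=> _ _ []. Qed.

Lemma partner_uniq s t t' : partner s t -> partner s t' -> t = t'.
Proof.
case=> g [] g'; first exact: gradient_upper_uniq g g'.
- by case: (gradient_trans_absurd g' g).
- by case: (gradient_trans_absurd g g').
- exact: gradient_lower_uniq g g'.
Qed.

(** The steps of a possibly illegal path: unlike [hasse], this allows the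
    backward arrows. *)
Definition arrow (a b : simplex) : Prop :=
  gradient a b \/ [/\ K a, K b & facet b a].

Lemma hasseP a b : hasse a b <-> arrow a b /\ ~ gradient b a.
Proof.
split=> [[g|[Ka Kb ba ng]]|[[g|[Ka Kb ba]] ng]].
- split; first by left.
  by move=> g'; move: (gradient_dim g) (gradient_dim g'); lia.
- by split=> //; right.
- by left.
- by right.
Qed.

Lemma arrow_complex a b : arrow a b -> K a /\ K b.
Proof. by case=> -[]. Qed.

Lemma chain_hasse P : chain hasse P <-> chain arrow P /\ legal P.
Proof.
split=> [/chainP ch|[/chainP ch lP]].
  split; first by apply/chainP => x y /ch/hasseP[].
  by case=> t [s [/ch/hasseP[]]].
apply/chainP => x y xy; apply/hasseP; split; first exact: ch.
by move=> g; apply: lP; exists x, y.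
Qed.

Lemma path_arrow x s : chain_from hasse x s -> chain_from arrow x s.
Proof. by move=> /(chain_hasse (x :: s))[]. Qed.

(** Only an up step starting at [x] can lead above the dimension of [x], since
    two consecutive up steps would put their middle simplex into two pairs. *)
Lemma path_dim_le x s : chain_from arrow x s ->
  (forall z, z \in s -> dim z <= (dim x).+1) /\
  ((forall y, ~ gradient x y) -> forall z, z \in s -> dim z <= dim x).
Proof.
elim: s x => [|y s IH] x //= /andP[/asboolP xy /IH[le1 le0]].
case: xy => [g|[_ _ [_ dxy]]]; split.
- move=> z; rewrite inE => /predU1P[->|zs]; first by rewrite (gradient_dim g).
  rewrite -(gradient_dim g); apply: le0 => // w; exact: gradient_trans_absurd g.
- by move=> /(_ y).
- by move=> z; rewrite inE => /predU1P[->|/le1]; lia.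
- by move=> _ z; rewrite inE => /predU1P[->|/le1]; lia.
Qed.

(** The mirror image of [path_dim_le]: no up step can lead to the critical end
    of the path, and no two up steps are consecutive. *)
Lemma path_dim_ge x s : chain_from arrow x s -> critical (last x s) ->
  dim (last x s) <= dim x /\
  forall w, gradient w x -> dim (last x s) < dim x.
Proof.
elim: s x => [|y s IH] x /=.
  by move=> _ [_ cx]; split=> // w g; case: (cx w); right.
move=> /andP[/asboolP xy ch] cl; have [ge lt] := IH y ch cl.
case: xy => [g|[_ _ [_ dxy]]].
  split=> [|w g']; first by have := lt _ g; rewrite (gradient_dim g).
  by case: (gradient_trans_absurd g' g).
by split=> *; lia.
Qed.

Definition index2 (P : seq simplex) : Prop :=
  [/\ critical (head fset0 P), critical (last fset0 P),
      dim (head fset0 P) = (dim (last fset0 P) + 2)%N & chain arrow P].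

Lemma flowlineP P : flowline K f P <-> index2 P /\ legal P.
Proof.
split=> [[a [s [-> [ca cl] da /chainP/chain_hasse[ch lP]]]]|].
  by [].
case: P => [[[[/complex_neq0]]]|a s [[ca cl da ch] lP]]; first by rewrite eqxx.
by exists a, s; split=> //; apply/chainP/chain_hasse.
Qed.

Lemma index2_cat p a b c q :
  index2 (p ++ [:: a; b; c] ++ q) <->
  [/\ critical (head a p), critical (last c q),
      dim (head a p) = (dim (last c q) + 2)%N &
      [/\ chain arrow (rcons p a), arrow a b, arrow b c &
          chain_from arrow c q]].
Proof.
rewrite /index2 last_cat /= sorted_cat_cons /=.
have -> : head fset0 (p ++ a :: b :: c :: q) = head a p by case: p.
split=> [[? ? ? /and4P[? /asboolP ? /asboolP ? ?]]|[? ? ? [? ? ? ?]]] //.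
by split=> //; apply/and4P; split=> //; apply/asboolP.
Qed.

Lemma index2_dim P z : index2 P -> z \in P ->
  dim (last fset0 P) <= dim z <= dim (head fset0 P).
Proof.
move=> [ch cl _ PP] zP; apply/andP; split.
  case/splitPr: zP cl PP => p q; rewrite last_cat /= sorted_cat_cons.
  by move=> cl /andP[_ /path_dim_ge/(_ cl)[]].
case: P ch zP PP {cl} => //= x s [_ cx]; rewrite inE => /predU1P[->//|zs].
by move=> /path_dim_le[_]; apply=> // y g; apply: (cx y); left.
Qed.

Lemma double_drop_dim P p a b c q : index2 P -> double_drop P p a b c q ->
  [/\ dim a = dim (head fset0 P), dim c = dim (last fset0 P) &
      forall z, z \in [:: b, c & q] -> dim z < dim a].
Proof.
move=> ix [E [_ ba] [_ cb]].
have /andP[_ lea] : dim (last fset0 P) <= dim a <= dim (head fset0 P).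
  by apply: index2_dim => //; rewrite E mem_cat mem_head orbT.
have /andP[gec _] : dim (last fset0 P) <= dim c <= dim (head fset0 P).
  by apply: index2_dim => //; rewrite E mem_cat !inE eqxx !orbT.
have [_ _ dhl PP] := ix.
move: PP; rewrite {1}E sorted_cat_cons /= => /and4P[_ _ _ cq].
split; [lia | lia |] => z; rewrite !inE => /or3P[/eqP->|/eqP->|]; [lia|lia|].
by move=> /(path_dim_le cq).1; lia.
Qed.

(** The double drop starts at the last simplex of the starting dimension. *)
Lemma double_drop_uniq P p a b c q p' a' b' c' q' : index2 P ->
    double_drop P p a b c q -> double_drop P p' a' b' c' q' ->
  [/\ p = p', a = a', b = b', c = c' & q = q'].
Proof.
move=> ix dd dd'.
have [da _ lt] := double_drop_dim ix dd.
have [da' _ lt'] := double_drop_dim ix dd'.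
have [E _ _] := dd; have [E' _ _] := dd'.
have [|||||] :=
  @last_split_inj _ (fun z => dim a <= dim z) p p'
    [:: b, c & q] [:: b', c' & q'] a a'.
- by [].
- by rewrite da da'.
- by apply/hasPn => z /lt; rewrite -ltnNge.
- by apply/hasPn => z /lt'; rewrite da da' -ltnNge.
- by rewrite -[LHS]E -[RHS]E'.
- by move=> -> -> [-> -> ->].
Qed.

(** * Flop, insert and cancel on paths *)

(** An index-two path whose backward arrows, if any, touch the intermediate
    simplex [b]: only such paths occur in the algorithm. *)
Definition near_legal P p a b c q : Prop :=
  [/\ index2 P, double_drop P p a b c q, chain hasse (rcons p a) &
      chain_from hasse c q].

Definition nearly_legal P : Prop :=
  exists p a b c q, near_legal P p a b c q.

(** Every flowline has a double drop, by a count of its up and down steps. The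
    floperations preserve the existence of a double drop, so that carrying it
    along replaces this count. *)
Definition dropping_flowline F : Prop :=
  flowline K f F /\ exists p a b c q, double_drop F p a b c q.

Lemma index2_double_drop_arrows P p a b c q : index2 P ->
    double_drop P p a b c q ->
  [/\ K a, K b, K c, arrow a b & arrow b c].
Proof.
move=> ix [E _ _]; move: ix; rewrite E => /index2_cat[_ _ _ [_ ab bc _]].
by have [? ?] := arrow_complex ab; have [_ ?] := arrow_complex bc.
Qed.

Lemma dropping_flowlineP F : dropping_flowline F <->
  exists p a b c q,
    [/\ near_legal F p a b c q, ~ gradient b a & ~ gradient c b].
Proof.
split.
  move=> [/flowlineP[ix lF] [p [a [b [c [q dd]]]]]]; exists p, a, b, c, q.
  have [_ _ _ ch] := ix; have := (chain_hasse _).2 (conj ch lF).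
  have [E _ _] := dd; rewrite {1}E /= sorted_cat_cons /=.
  move=> /and4P[pa /asboolP/hasseP[_ nba] /asboolP/hasseP[_ ncb] cq].
  by split.
move=> [p [a [b [c [q [[ix dd pa cq] nba ncb]]]]]].
split; last by exists p, a, b, c, q.
have [_ _ _ ab bc] := index2_double_drop_arrows ix dd.
apply/flowlineP; split=> //; apply: proj2 ((chain_hasse F).1 _) => {ix}.
have [-> _ _] := dd; rewrite /= sorted_cat_cons /= pa cq andbT /=.
by apply/andP; split; apply/asboolP/hasseP.
Qed.

Lemma critical_flowlineP F p a b c q : flowline K f F ->
  double_drop F p a b c q -> (critical_flowline K f F <-> critical b).
Proof.
move=> fF dd; split=> [[_ [p' [a' [b' [c' [q' [dd' cb]]]]]]]|cb].
  have [ix _] := (flowlineP F).1 fF.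
  by have [_ _ -> _ _] := double_drop_uniq ix dd dd'.
by split=> //; exists p, a, b, c, q.
Qed.

Lemma is_flop_sym (P Q : seq simplex) : is_flop P Q -> is_flop Q P.
Proof.
move=> [p [a [b [c [q [b' [[EP ba cb] b'b b'a cb' EQ]]]]]]].
exists p, a, b', c, q, b; split=> //; exact/nesym.
Qed.

Lemma flopE (P Q : seq simplex) : index2 P -> is_flop P Q -> flop P = Q.
Proof.
move=> ix flPQ; apply: (xget_unique _ flPQ) => Q' flPQ'.
have [p [a [b [c [q [b1 [dd b1b b1a cb1 ->]]]]]]] := flPQ.
have [p' [a' [b' [c' [q' [b2 [dd' b2b b2a cb2 ->]]]]]]] := flPQ'.
have [Ep Ea Eb Ec Eq] := double_drop_uniq ix dd dd'; subst p' a' b' c' q'.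
have [_ _ Kc _ _] := index2_double_drop_arrows ix dd; have [_ ba cb] := dd.
have [s [_ _ _ _ uniq_s]] := facet_diamond (complex_neq0 Kc) cb ba.
by rewrite (uniq_s b1) // (uniq_s b2).
Qed.

(** A flop leaves every arrow away from the intermediate simplex unchanged. *)
Lemma flop_nearly_legal P : nearly_legal P ->
  nearly_legal (flop P) /\ flop (flop P) = P.
Proof.
move=> [p [a [b [c [q [ix dd pa cq]]]]]].
have [Ka _ Kc _ _] := index2_double_drop_arrows ix dd; have [E ba cb] := dd.
have [b' [b'0 b'b cb' b'a _]] := facet_diamond (complex_neq0 Kc) cb ba.
have Kb' : K b' by apply: (hK.2 _ _ Ka) => //; case: b'a.
have flPQ : is_flop P (p ++ [:: a; b'; c] ++ q).
  by exists p, a, b, c, q, b'.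
have ixQ : index2 (p ++ [:: a; b'; c] ++ q).
  move: ix; rewrite E => /index2_cat[? ? ? [? ? ? ?]]; apply/index2_cat.
  by split=> //; split=> //; right.
rewrite (flopE ix flPQ) (flopE ixQ (is_flop_sym flPQ)); split=> //.
by exists p, a, b', c, q; split.
Qed.

Lemma insertE P Q : index2 P -> is_insert K f P Q -> insert K f P = Q.
Proof.
move=> ix inPQ; apply: (xget_unique _ inPQ) => Q' inPQ'.
have [p [a [b [c [q [d [dd bd ->]]]]]]] := inPQ.
have [p' [a' [b' [c' [q' [d' [dd' bd' ->]]]]]]] := inPQ'.
have [Ep Ea Eb Ec Eq] := double_drop_uniq ix dd dd'; subst p' a' b' c' q'.
by rewrite (partner_uniq bd bd').
Qed.

(** A path has at most one arrow to cancel, because its intermediate simplex is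
    in at most one pair. *)
Lemma cancelE P Q : index2 P -> is_cancel K f P Q -> cancel K f P = Q.
Proof.
move=> ix caPQ; apply: (xget_unique _ caPQ) => Q'.
case: caPQ => [[p [b [d [c [q [dd g ->]]]]]]|[p [a [b [d [q [dd g ->]]]]]]];
case=> [[p' [b' [d' [c' [q' [dd' g' ->]]]]]]|[p' [a' [b' [d' [q' [dd' g' ->]]]]]]];
have [Ep Ea Eb Ec Eq] := double_drop_uniq ix dd dd'.
- by have [-> ->] := rcons_inj Ep; subst.
- by subst; case: (gradient_trans_absurd g' g).
- by subst; case: (gradient_trans_absurd g g').
- by subst; case: Eq => ->.
Qed.

(** The partner [d] of the intermediate simplex [b] lies above or below it. The
    walk [b, d, b] then ends, respectively begins, with the only backward arrow,
    and the double drop moves to [d, b, c], respectively [a, b, d]; in both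
    cases that backward arrow touches the new intermediate simplex. *)
Lemma insert_nearly_legal F :
    dropping_flowline F -> ~ critical_flowline K f F ->
  [/\ nearly_legal (insert K f F), illegal K f (insert K f F) &
      cancel K f (insert K f F) = F].
Proof.
move=> dF ncF; have [fF _] := dF.
have [p [a [b [c [q [[ix dd pa cq] nba ncb]]]]]] := (dropping_flowlineP F).1 dF.
have [Ka Kb Kc ab bc] := index2_double_drop_arrows ix dd; have [E ba cb] := dd.
have [d bd] : exists d, partner b d.
  apply: contrapT => nb; apply: ncF; apply/(critical_flowlineP fF dd).
  by split=> // t bt; apply: nb; exists t.
rewrite (@insertE F (p ++ [:: a; b; d; b; c] ++ q)) //; last first.
  by exists p, a, b, c, q, d.
have Kd : K d by case: bd => -[].
have dK : forall x y, gradient x y -> facet x y by move=> x y [].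
have [abd dbc] : arrow b d /\ arrow d b.
  by case: bd => g; split; (try by left); right; split=> //; apply: dK.
have := ix; rewrite {1}E => /index2_cat[hd hl dhl [pa' _ _ cq']].
have ixQ : index2 (p ++ [:: a; b; d; b; c] ++ q).
  rewrite -[_ ++ q]/([:: a; b; d] ++ [:: b, c & q]).
  apply/index2_cat; split=> //; split=> //=.
  by rewrite cq' andbT; apply/andP; split; apply/asboolP.
have ill : illegal K f (p ++ [:: a; b; d; b; c] ++ q).
  case: bd => g; [exists d, b | exists b, d]; split=> //; apply/infixP.
    by exists (p ++ [:: a; b]), (c :: q); rewrite -catA.
  by exists (rcons p a), [:: b, c & q]; rewrite cat_rcons.
have hab : hasse a b by apply/hasseP.
have hbc : hasse b c by apply/hasseP.
case: bd => g.
  have dd' : double_drop (p ++ [:: a; b; d; b; c] ++ q)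
      (rcons (rcons p a) b) d b c q.
    by split=> //; [rewrite !cat_rcons | apply: dK].
  split=> //; last first.
    apply: cancelE => //; left; exists (rcons p a), b, d, c, q.
    by split=> //; rewrite cat_rcons -E.
  exists (rcons (rcons p a) b), d, b, c, q; split=> //.
  have hbd : hasse b d by left.
  rewrite -!cats1 -!catA /= sorted_cat_cons pa /=.
  by rewrite andbT; apply/andP; split; apply/asboolP.
have dd' : double_drop (p ++ [:: a; b; d; b; c] ++ q) p a b d [:: b, c & q].
  by split=> //; apply: dK.
split=> //; last by apply: cancelE => //; right; exists p, a, b, d, (c :: q).
exists p, a, b, d, [:: b, c & q]; split=> //=.
have hdb : hasse d b by left.
by rewrite cq andbT; apply/andP; split; apply/asboolP.
Qed.

(** In a nearly legal path a backward arrow enters or leaves the intermediate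
    simplex [b]. Its other end is not critical, so the path continues beyond it,
    and for reasons of dimension it does so along an up arrow: this is the Morse
    arrow joining [b] with its partner. Cancelling exposes as new intermediate
    simplex the other occurrence of [b], which is paired; so the result is a
    noncritical flowline, and inserting recovers the path. *)
Lemma cancel_nearly_legal P : nearly_legal P -> illegal K f P ->
  [/\ dropping_flowline (cancel K f P), ~ critical_flowline K f (cancel K f P) &
      insert K f (cancel K f P) = P].
Proof.
move=> [p [a [b [c [q [ix dd pa cq]]]]]] ill.
have [Ka Kb Kc ab bc] := index2_double_drop_arrows ix dd; have [E ba cb] := dd.
have [da dc _] := double_drop_dim ix dd.
have := ix; rewrite {1}E => /index2_cat[hd hl dhl _].
(* It suffices to exhibit a flowline into which the insertion gives [P]. *)
have done_by F p' a' b' c' q' d :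
    near_legal F p' a' b' c' q' -> ~ gradient b' a' -> ~ gradient c' b' ->
    partner b' d -> P = p' ++ [:: a'; b'; d; b'; c'] ++ q' ->
    is_cancel K f P F ->
  [/\ dropping_flowline (cancel K f P), ~ critical_flowline K f (cancel K f P) &
      insert K f (cancel K f P) = P].
  move=> nF n1 n2 bd EP /(cancelE ix) ->.
  have dF : dropping_flowline F.
    by apply/dropping_flowlineP; exists p', a', b', c', q'.
  have [ixF ddF _ _] := nF; split=> //.
    by move/(critical_flowlineP dF.1 ddF) => [_ /(_ _ bd)].
  by apply: insertE => //; exists p', a', b', c', q', d.
have [gba|gcb] : gradient b a \/ gradient c b.
  apply: contrapT => ng.
  have [/flowlineP[_ lP] _] : dropping_flowline P; last exact: lP ill.
  apply/dropping_flowlineP; exists p, a, b, c, q.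
  by split=> // g; apply: ng; [left | right].
- have ncb : ~ gradient c b by move=> g; exact: gradient_trans_absurd g gba.
  case/lastP: p E dd pa hd dhl => [|p z] E dd pa hd dhl.
    by case: hd => _ /(_ b); case; right.
  move: (pa); rewrite -cats1 cat_rcons sorted_cat_cons /= andbT.
  move=> /andP[pz /asboolP za].
  have zb : z = b.
    case: za => [g|[_ _ [_ dz] _]]; first exact: gradient_lower_uniq g gba.
    have /andP[] : dim (last fset0 P) <= dim z <= dim (head fset0 P).
      by apply: index2_dim => //; rewrite E mem_cat mem_rcons mem_head.
    lia.
  subst z; case/lastP: p E dd pa pz hd dhl => [|p e] E dd pa pz hd dhl.
    by case: hd => _ /(_ a); case; left.
  move: (pz); rewrite -cats1 cat_rcons sorted_cat_cons /= andbT.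
  move=> /andP[pe /asboolP/hasseP[eb nbe]].
  have be : facet b e by case: eb => [/gradient_trans_absurd/(_ gba)|[]].
  apply: (done_by (p ++ [:: e; b; c] ++ q) p e b c q a) => //.
  + split=> //; apply/index2_cat; split=> //.
    * by move: hd; rewrite !head_rcons.
    * by move: dhl; rewrite !head_rcons.
    * split=> //; last exact: path_arrow.
      exact: ((chain_hasse _).1 pe).1.
  + by left.
  + by rewrite E !cat_rcons.
  + left; exists (rcons p e), b, a, c, q; split=> //.
    by rewrite cat_rcons.
- have nba : ~ gradient b a by move=> g; exact: gradient_trans_absurd gcb g.
  case: q E dd cq hl dhl => [|z q] E dd cq hl dhl.
    by case: hl => _ /(_ b); case; left.
  move: (cq) => /= /andP[/asboolP cz zq].
  have zb : z = b.
    case: cz => [g|[_ _ [_ dz] _]]; first exact: gradient_upper_uniq g gcb.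
    have /andP[] : dim (last fset0 P) <= dim z <= dim (head fset0 P).
      by apply: index2_dim => //; rewrite E mem_cat !inE eqxx !orbT.
    lia.
  subst z; case: q E dd cq zq hl dhl => [|e q] E dd cq zq hl dhl.
    by case: hl => _ /(_ c); case; right.
  move: (zq) => /= /andP[/asboolP/hasseP[be neb] eq].
  have eb : facet e b by case: be => [/(gradient_trans_absurd gcb)|[]].
  apply: (done_by (p ++ [:: a; b; e] ++ q) p a b e q c) => //.
  + split=> //; apply/index2_cat; split=> //; split=> //.
      exact: ((chain_hasse _).1 pa).1.
    exact: path_arrow.
  + by right.
  + by right; exists p, a, b, c, (e :: q).
Qed.

(** * Running the algorithm backwards *)

Local Notation entry := (seq simplex * label)%type.

Definition conj_entry (e : entry) : entry := (e.1, conj_label e.2).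

(** The path flopped by the algorithm right after it has listed [e]. *)
Definition departure (e : entry) : seq simplex :=
  if e.2 is cs then e.1 else insert K f e.1.

Definition continues (e : entry) : Prop :=
  dropping_flowline e.1 /\ (e.2 = fs -> ~ critical_flowline K f e.1).

(** Whichever label [e'] has, the path that made the algorithm list [e'] is
    [departure (conj_entry e')]: this path is the flowline itself under label
    [fs], and under label [cs] it is the illegal path that was cancelled, which
    an insertion restores. In this form the relation is visibly symmetric. *)
Definition next (e e' : entry) : Prop :=
  [/\ continues e, continues (conj_entry e') &
      flop (departure e) = departure (conj_entry e')].

(** The run of the algorithm once it has listed [e]: it stops there exactly when
    [e] is a critical flowline with label [fs]. *)
Definition alg_after (e : entry) (L : seq entry) : Prop :=
  [/\ e.2 = fs, critical_flowline K f e.1 & L = [::]] \/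
  continues e /\ alg_loop K f (flop (departure e)) L.

Lemma conj_labelK : involutive conj_label.
Proof. by case. Qed.

Lemma conj_entryK : involutive conj_entry.
Proof. by case=> F l; rewrite /conj_entry /= conj_labelK. Qed.

Lemma dropping_nearly_legal F : dropping_flowline F -> nearly_legal F.
Proof.
by move=> /dropping_flowlineP[p [a [b [c [q [nF _ _]]]]]]; exists p, a, b, c, q.
Qed.

Lemma departure_nearly_legal e : continues e -> nearly_legal (departure e).
Proof.
case: e => F [] [/= dF nc]; first exact: dropping_nearly_legal.
by have [] := insert_nearly_legal dF (nc erefl).
Qed.

Lemma next_conj e e' : next e e' -> next (conj_entry e') (conj_entry e).
Proof.
move=> [ce ce' E]; split; rewrite ?conj_entryK // -E.
by have [] := flop_nearly_legal (departure_nearly_legal ce).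
Qed.

(** One round of the algorithm: a flop ends in a legal path, listed under [fs],
    or in an illegal one, whose cancellation is listed under [cs]. *)
Lemma alg_loop_next e L : continues e ->
  alg_loop K f (flop (departure e)) L <->
  exists e' L', [/\ L = e' :: L', next e e' & alg_after e' L'].
Proof.
move=> ce; have [nP _] := flop_nearly_legal (departure_nearly_legal ce).
split.
  move EP : (flop (departure e)) nP => P nP lo.
  case: lo EP nP => {P} [P L' ill lo|P leg cP|P L' leg ncP lo] EP nP.
  - have [dF ncF iF] := cancel_nearly_legal nP ill.
    exists (cancel K f P, cs), L'; split=> //; first by split=> //; rewrite EP.
    by right.
  - have dP : dropping_flowline P.
      split; first exact: cP.1.
      by case: nP => [p [a [b [c [q []]]]]]; exists p, a, b, c, q.
    by exists (P, fs), [::]; split=> //; left.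
  - have dP : dropping_flowline P.
      case: nP => [p [a [b [c [q [ix dd _ _]]]]]].
      by split; [exact/flowlineP | exists p, a, b, c, q].
    by exists (P, fs), L'; split=> //; right.
move=> [[F []] [L' [-> [_ [/= dF nc] E] aft]]]; rewrite E /departure /=.
  have [_ ill caF] := insert_nearly_legal dF (nc erefl).
  rewrite -{2}caF; apply: alg_cancel => //; rewrite caF.
  by case: aft => [[]//|[_]].
have leg : legal F by have [_] := (flowlineP F).1 dF.1.
case: aft => [[_ cF ->]|[[_ ncF] lo]]; first exact: alg_stop.
by apply: alg_insert => //; apply: ncF.
Qed.

(** The reversed run is built from its end: by [next_conj], each step of the
    given run prepends one conjugated entry to the list [M] of what comes after
    [conj_entry e]. *)
Lemma alg_after_conj e L M : alg_after e L -> alg_after (conj_entry e) M ->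
  let z := last e L in
  [/\ z.2 = fs, critical_flowline K f z.1 &
      alg_after (conj_entry z) (rev (map conj_entry (belast e L)) ++ M)].
Proof.
elim: L e M => [|e1 L IH] e M.
  case=> [[l ce _] aft|[ce /(alg_loop_next _ ce)[? [? []]]//]]; by split.
case=> [[]//|[ce /(alg_loop_next _ ce)[_ [_ [[<- <-] nx aft]]]]] aftM /=.
rewrite rev_cons cat_rcons; apply: IH aft _; right.
have nx' := next_conj nx; have [ce1 _ _] := nx'; split=> //.
by apply/(alg_loop_next _ ce1); exists (conj_entry e), M.
Qed.
End Paths.

Theorem lemma4p1 (R : realType) (T : choiceType) (K : set {fset T})
    (f : {fset T} -> R) (F0 Fn : seq {fset T}) (n : nat)
    (L1 : seq (seq {fset T} * label))
    (hK : simplicial_complex K) (hf : discrete_morse K f)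
    (hF0 : critical_flowline K f F0)
    (hL1 : alg_list K f F0 L1) (hn : size L1 = n.+1)
    (hFn : last F0 (unzip1 L1) = Fn) :
  critical_flowline K f Fn /\
  exists L2 : seq (seq {fset T} * label),
    alg_list K f Fn L2 /\
    last Fn (unzip1 L2) = F0 /\
    forall i : nat, i <= n ->
      exists (F : seq {fset T}) (l : label),
        onth L2 i = Some (F, l) /\ onth L1 (n - i) = Some (F, conj_label l).
Proof.
have [L [EL1 lo]] := hL1.
have dF0 : dropping_flowline K f F0.
  have [fF [p [a [b [c [q [dd _]]]]]]] := hF0.
  by split=> //; exists p, a, b, c, q.
have aft : alg_after K f (F0, cs) L by right.
have aft0 : alg_after K f (conj_entry (F0, cs)) [::] by left.
have [] := alg_after_conj hK hf aft aft0.
have Ez : (last (F0, cs) L).1 = Fn.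
  by rewrite -hFn EL1 /unzip1 /= (last_map fst L (F0, cs)).
case: last (lastI (F0, cs) L) Ez => [F l] EL /= EFn El cz; subst F l.
rewrite cats0.
case=> [[]//|[_ loz]].
split=> //; set L2 := rev (map (@conj_entry T) L1); exists L2.
have EL2 : L2 = (Fn, cs) :: rev (map (@conj_entry T) (belast (F0, cs) L)).
  by rewrite /L2 EL1 EL map_rcons rev_rcons.
split; first by exists (rev (map (@conj_entry T) (belast (F0, cs) L))).
split.
  by rewrite /L2 EL1 /= rev_cons /unzip1 map_rcons last_rcons.
move=> i le_in; pose e := nth (F0, cs) L1 (n - i).
exists e.1, (conj_label e.2); rewrite conj_labelK !onthE; split.
  rewrite (nth_map (F0, cs)) ?size_rev ?size_map ?hn //.
  rewrite nth_rev ?size_map ?hn // subSS.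
  rewrite (nth_map (F0, cs)) ?hn ?ltnS ?leq_subr //.
by rewrite (nth_map (F0, cs)) ?hn ?ltnS ?leq_subr // -/e; case: e.
Qed.
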